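(* Let $\alpha>0$, let $v(n)$ be the velocity at time $n$ of the Slicer Map with parameter $\alpha$, and let $R_\alpha=\sum_{k=1}^\infty\Delta_{2k}(\alpha)$. (i) As $n_2\to\infty$, $\langle v(0)v(n_2)\rangle\to1-4R_\alpha$ along even $n_2$ and $\langle v(0)v(n_2)\rangle\to-1+4R_\alpha$ along odd $n_2$. (ii) As $n_1\to\infty$ with $n_2>n_1$: if $n_1$ and $n_2$ are both even or both odd, then $\langle v(n_1)v(n_2)\rangle\to1$; if one of $n_1,n_2$ is even and the other is odd, then $\langle v(n_1)v(n_2)\rangle\to-1$.
   Context: For $\alpha>0$ and $m\in\mathbb Z$ let $\ell_m=(|m|+2^{1/\alpha})^{-\alpha}$. The Slicer Map $S_\alpha:[0,1]\times\mathbb Z\to[0,1]\times\mathbb Z$ is $S_\alpha(x,m)=(x,m-1)$ if $0\le x\le \ell_m$ or $\tfrac12<x\le 1-\ell_m$, and $S_\alpha(x,m)=(x,m+1)$ if $\ell_m<x\le\tfrac12$ or $1-\ell_m<x\le 1$. Initial conditions are $(x,0)$ with $x$ uniform in the right half of the unit interval. Put $\ell_k^+=1-\ell_k$ and $\Delta_k(\alpha)=\ell_k^+-\ell_{k-1}^+$ for $k\ge1$. The velocity (the increment $\pm1$ of the cell index at step $n$) of a particle with $x\in[\ell^+_{k-1},\ell^+_k)$ is, up to a null set of initial conditions, $v_k(n)=1$ if $n<k$ and $v_k(n)=-(-1)^{n-k}$ if $n\ge k$. The velocity auto-correlation function is $\langle v(n_1)v(n_2)\rangle=2\sum_{k=1}^{\infty}v_k(n_1)v_k(n_2)\,\Delta_k(\alpha)$.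 *)

(* Defs.v *)
From mathcomp Require Import all_boot all_order all_algebra.
From mathcomp Require Import all_classical all_reals all_analysis.

Set Implicit Arguments.
Unset Strict Implicit.
Unset Printing Implicit Defensive.

Import Order.TTheory GRing.Theory Num.Theory.
Import numFieldNormedType.Exports.

Local Open Scope classical_set_scope.
Local Open Scope ring_scope.

Definition slicer_ell (R : realType) (a : R) (m : int) : R :=
  (`|m|%:~R + 2 `^ a^-1) `^ (- a).

Definition slicer_ell_plus (R : realType) (a : R) (m : int) : R :=
  1 - slicer_ell a m.

(* Only used for [0 < k]. *)
Definition slicer_Delta (R : realType) (a : R) (k : nat) : R :=
  slicer_ell_plus a k%:Z - slicer_ell_plus a k.-1%:Z.

(* The state space [0, 1] * Z is embedded in R * int. The two tests cover
   [0, 1], which is preserved; the last branch is only reached outside it. *)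
Definition slicer_map (R : realType) (a : R) (p : R * int) : R * int :=
  let: (x, m) := p in
  if (0 <= x <= slicer_ell a m) || (2^-1 < x <= 1 - slicer_ell a m)
  then (x, m - 1)
  else if (slicer_ell a m < x <= 2^-1) || (1 - slicer_ell a m < x <= 1)
  then (x, m + 1)
  else (x, m).

(* Cell occupied at time [n] by the particle started at [(x, 0)]. *)
Definition slicer_cell (R : realType) (a : R) (n : nat) (x : R) : int :=
  (iter n (slicer_map a) (x, 0)).2.

(* Time [0] is the first step: the velocity at time [n] is the increment from
   time [n] to time [n.+1]. *)
Definition slicer_velocity (R : realType) (a : R) (n : nat) (x : R) : R :=
  (slicer_cell a n.+1 x - slicer_cell a n x)%:~R.

Lemma half_lt1 (R : realType) : (2^-1 : R) < 1.
Proof. by rewrite invf_lt1// ltr1n. Qed.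

(* Expectation of v(n1) v(n2) for x uniform on the right half [1/2, 1]. Since
   v(n1) v(n2) is constant on each interval ]ell+_(k-1), ell+_k[ (k >= 1), of length
   Delta_k, and the uniform density is 2, this is the series
   2 \sum_(k >= 1) v_k(n1) v_k(n2) Delta_k. The integrand is bounded and
   measurable, so [fine] is applied to a finite value. *)
Definition slicer_vacf (R : realType) (a : R) (n1 n2 : nat) : R :=
  fine ('E_(uniform_prob (half_lt1 R))
          [(fun x : R => slicer_velocity a n1 x * slicer_velocity a n2 x)%R])%E.

(* The sum of Delta_(2 k) over k >= 1. *)
Definition slicer_R (R : realType) (a : R) : R :=
  limn (series (fun j : nat => slicer_Delta a j.+1.*2)).

(* Main.v *)
(* A particle started in ]ell+_(k-1), ell+_k] climbs to cell k and then
   oscillates between k and k-1, so v(n1) v(n2) is a step function of the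
   initial condition. Integrating v(n1) v(n2) - 1, which vanishes for
   k > max(n1, n2), leaves a finite sum:
     <v(n1) v(n2)> = 1 + 2 \sum_(k <= N) (v_k(n1) v_k(n2) - 1) Delta_k
   for any N >= n1, n2. When n1 = 0 and n2 is even, this is exactly 1 - 4 times
   a partial sum of the series R_alpha; when n2 is odd, the odd-indexed Delta_k
   appear instead, and they are complementary since \sum_k Delta_k = 1/2. In
   general the terms with k <= n1 carry the product (-1)^(n1+n2), and the
   remaining ones have total length at most ell_(n1), which tends to 0. *)

Require Import Defs.
From mathcomp Require Import all_boot all_order all_algebra.
From mathcomp Require Import all_classical all_reals all_analysis.
From mathcomp Require Import measurable_realfun.
From mathcomp Require Import zify ring lra.

Import Order.TTheory GRing.Theory Num.Theory.
Import numFieldNormedType.Exports.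

Local Open Scope classical_set_scope.
Local Open Scope ring_scope.

(** * Monotonicity, limit and telescoping of the slicer positions *)

Lemma slicer_base_gt0 {R : realType} (a : R) (m : int) :
  0 < `|m|%:~R + 2 `^ a^-1 :> R.
Proof. by rewrite ltr_wpDl ?ler0z// powR_gt0. Qed.

Lemma slicer_ell_gt0 {R : realType} (a : R) (m : int) : 0 < slicer_ell a m.
Proof. by rewrite powR_gt0// slicer_base_gt0. Qed.

Lemma slicer_ell0 {R : realType} (a : R) : 0 < a -> slicer_ell a 0 = 2^-1.
Proof.
by move=> a0; rewrite /slicer_ell normr0 add0r powRN -powRrM mulVf ?gt_eqF// powRr1.
Qed.

Lemma slicer_ell_anti {R : realType} (a : R) (m n : nat) : 0 < a ->
  (m <= n)%N -> slicer_ell a n%:Z <= slicer_ell a m%:Z.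
Proof.
move=> a0 mn; rewrite /slicer_ell !powRN lef_pV2 ?posrE ?powR_gt0 ?slicer_base_gt0//.
apply: ge0_ler_powR; rewrite ?nnegrE ?(ltW a0) ?(ltW (slicer_base_gt0 _ _))//.
by rewrite lerD2r ler_int lez_nat.
Qed.

Lemma slicer_ell_cvg0 {R : realType} (a : R) : 0 < a ->
  slicer_ell a n%:Z @[n --> \oo] --> 0.
Proof.
move=> a0; apply/cvgr0Pnorm_lt => e e0.
near=> n.
rewrite gtr0_norm ?slicer_ell_gt0// /slicer_ell powRN.
rewrite -[ltRHS]invrK ltf_pV2 ?posrE ?invr_gt0// ?powR_gt0 ?slicer_base_gt0//.
(* With $e^{-1}$ written as an $\alpha$-th power only the bases need comparing, which $n\ge
   e^{-1/\alpha}$ settles. *)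
have -> : e^-1 = (e^-1 `^ a^-1) `^ a.
  by rewrite -powRrM mulVf ?gt_eqF// powRr1// invr_ge0 ltW.
apply: gt0_ltr_powR; rewrite ?nnegrE ?powR_ge0 ?(ltW (slicer_base_gt0 _ _))//.
rewrite ltr_pwDr ?powR_gt0//.
by near: n; exact: nbhs_infty_ger.
Unshelve. all: end_near. Qed.

Lemma slicer_ell_plus_homo {R : realType} (a : R) (m n : nat) : 0 < a ->
  (m <= n)%N -> slicer_ell_plus a m%:Z <= slicer_ell_plus a n%:Z.
Proof. by move=> a0 mn; rewrite lerD2l lerN2 slicer_ell_anti. Qed.

Lemma slicer_ell_plus0 {R : realType} (a : R) : 0 < a ->
  slicer_ell_plus a 0 = 2^-1.
Proof. by move=> a0; rewrite /slicer_ell_plus slicer_ell0//; lra. Qed.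

Lemma slicer_ell_plus_lt1 {R : realType} (a : R) (m : int) :
  slicer_ell_plus a m < 1.
Proof. by rewrite ltrBlDr ltrDl slicer_ell_gt0. Qed.

Lemma slicer_Delta_ge0 {R : realType} (a : R) (k : nat) : 0 < a ->
  0 <= slicer_Delta a k.
Proof. by move=> a0; rewrite subr_ge0 slicer_ell_plus_homo// leq_pred. Qed.

Lemma sum_slicer_Delta {R : realType} (a : R) (m n : nat) : (m <= n)%N ->
  \sum_(m <= k < n) slicer_Delta a k.+1 =
  slicer_ell_plus a n%:Z - slicer_ell_plus a m%:Z.
Proof. exact: (telescope_sumr (fun k : nat => slicer_ell_plus a k%:Z)). Qed.

(** * Trajectory of a single particle *)

(** The map fixes the first coordinate, so for given [x] the cell index evolves autonomously. *)
Definition slicer_step {R : realType} (a x : R) (m : int) : int :=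
  (slicer_map a (x, m)).2.

Lemma slicer_map_fst {R : realType} (a : R) (p : R * int) :
  (slicer_map a p).1 = p.1.
Proof. by case: p => x m /=; case: ifP => // _; case: ifP. Qed.

Lemma slicer_cellS {R : realType} (a : R) (n : nat) (x : R) :
  slicer_cell a n.+1 x = slicer_step a x (slicer_cell a n x).
Proof.
have fst_iter k : (iter k (slicer_map a) (x, 0)).1 = x.
  by elim: k => //= k IH; rewrite slicer_map_fst.
by rewrite /slicer_step /slicer_cell iterS [in LHS](surjective_pairing (iter n _ _)) fst_iter.
Qed.

Lemma slicer_step_up {R : realType} (a x : R) (m : nat) : 0 < a ->
  2^-1 < x <= 1 -> slicer_ell_plus a m%:Z < x -> slicer_step a x m%:Z = m%:Z + 1.
Proof.
rewrite /slicer_ell_plus => a0 /andP[x2 x1] mx; rewrite /slicer_step/=.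
(* As $\ell_m\le\tfrac12<x$, the left-half test of the first branch fails. *)
have ell2 : slicer_ell a m%:Z <= 2^-1 by rewrite -(slicer_ell0 a)// slicer_ell_anti.
by rewrite [x <= slicer_ell _ _]leNgt (le_lt_trans ell2)// andbF x2/= leNgt mx x1/= orbT.
Qed.

Lemma slicer_step_down {R : realType} (a x : R) (m : int) :
  2^-1 < x -> x <= slicer_ell_plus a m -> slicer_step a x m = m - 1.
Proof.
by rewrite /slicer_ell_plus /slicer_step/= => -> ->; rewrite orbT.
Qed.

(** By monotonicity [x] exceeds $\ell_m^+$ for all $m\le N$, so the steps out of cells $0,\dots,N$
    all go up; the last one reaches cell $N+1$. *)
Lemma slicer_cell_rising {R : realType} (a x : R) (N n : nat) : 0 < a ->
  2^-1 < x <= 1 -> slicer_ell_plus a N%:Z < x -> (n <= N.+1)%N ->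
  slicer_cell a n x = n%:Z.
Proof.
move=> a0 x21 Nx; elim: n => // n IH nN.
rewrite slicer_cellS IH 1?ltnW// slicer_step_up//; first by rewrite -PoszD addn1.
by apply: le_lt_trans Nx; apply: slicer_ell_plus_homo.
Qed.

(** Cell $k$ sends the particle up and cell $k+1$ sends it down; [d] counts the steps since it first
    reaches $k+1$. Closing the interval on the right matches the map's own test. *)
Lemma slicer_cell_trapped {R : realType} (a x : R) (k d : nat) : 0 < a ->
  2^-1 < x <= 1 -> slicer_ell_plus a k%:Z < x <= slicer_ell_plus a k.+1%:Z ->
  slicer_cell a (k.+1 + d) x = k.+1%:Z - (odd d)%:Z.
Proof.
move=> a0 x21 /andP[kx xk]; elim: d => [|d IH].
  by rewrite addn0 subr0; apply: (slicer_cell_rising _ _ k).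
rewrite addnS slicer_cellS IH /=; case: (odd d) => /=.
  have -> : k.+1%:Z - 1 = k%:Z by lia.
  by rewrite slicer_step_up//; lia.
by rewrite subr0 slicer_step_down//; case/andP: x21.
Qed.

(* The velocity v_k(n). *)
Definition trapped_velocity {R : realType} (k n : nat) : R :=
  if (n < k)%N then 1 else - (-1) ^+ (n - k).

Lemma slicer_velocity_rising {R : realType} (a x : R) (N n : nat) : 0 < a ->
  2^-1 < x <= 1 -> slicer_ell_plus a N%:Z < x -> (n <= N)%N ->
  slicer_velocity a n x = 1.
Proof.
move=> a0 x21 Nx nN; rewrite /slicer_velocity.
rewrite !(slicer_cell_rising a x N)//; last exact: leqW.
by rewrite -addn1 PoszD addrC addKr.
Qed.

Lemma slicer_velocity_trapped {R : realType} (a x : R) (k n : nat) : 0 < a ->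
  2^-1 < x <= 1 -> slicer_ell_plus a k%:Z < x <= slicer_ell_plus a k.+1%:Z ->
  slicer_velocity a n x = trapped_velocity k.+1 n.
Proof.
move=> a0 x21 xk; rewrite /trapped_velocity ltnS; case: leqP => [nk|kn].
  by apply: (slicer_velocity_rising _ _ k) => //; case/andP: xk.
rewrite /slicer_velocity -{1 2}(subnKC kn) -addnS !(slicer_cell_trapped _ _ k)//=.
rewrite -signr_odd; case: odd => /=.
  by rewrite expr1 opprK -[RHS]/(1%:~R); congr (intmul _ _); lia.
by rewrite expr0 -[RHS]/((-1)%:~R); congr (intmul _ _); lia.
Qed.

(** * Measurability, and expectation of a step function *)

(** The velocity is a piecewise constant function of [x] and the current cell, and the next cell is
    their sum with it, so both claims advance by one induction. *)
Lemma measurable_slicer_cell {R : realType} (a : R) (n : nat) :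
  measurable_fun [set: R] (fun x => (slicer_cell a n x)%:~R : R) /\
  measurable_fun [set: R] (slicer_velocity a n).
Proof.
have mvel k : measurable_fun [set: R] (fun x => (slicer_cell a k x)%:~R : R) ->
    measurable_fun [set: R] (slicer_velocity a k).
  move=> mcell.
  have mell : measurable_fun [set: R] (fun x => slicer_ell a (slicer_cell a k x)).
    rewrite /slicer_ell; under eq_fun do rewrite intr_norm.
    apply: (measurableT_comp (measurable_powR _)) => //.
    by apply: measurable_funD => //; exact: measurableT_comp.
  have -> : slicer_velocity a k = fun x =>
      if (0 <= x <= slicer_ell a (slicer_cell a k x)) ||
         (2^-1 < x <= 1 - slicer_ell a (slicer_cell a k x)) then -1
      else if (slicer_ell a (slicer_cell a k x) < x <= 2^-1) ||
              (1 - slicer_ell a (slicer_cell a k x) < x <= 1) then 1 else 0.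
    apply/funext => x; rewrite /slicer_velocity slicer_cellS /slicer_step/=.
    case: ifP => _ /=; first by rewrite addrAC subrr add0r.
    by case: ifP => _ /=; rewrite ?subrr// addrAC subrr add0r.
  apply: measurable_fun_ifT => //.
    apply: measurable_or; apply: measurable_and;
      (apply: measurable_fun_ler || apply: measurable_fun_ltr) => //.
    exact: measurable_funB.
  apply: measurable_fun_ifT => //.
  apply: measurable_or; apply: measurable_and;
    (apply: measurable_fun_ler || apply: measurable_fun_ltr) => //.
  exact: measurable_funB.
suff mcell : measurable_fun [set: R] (fun x => (slicer_cell a n x)%:~R : R).
  by split => //; exact: mvel.
elim: n => [|n IH]; first exact: measurable_cst.
have -> : (fun x => (slicer_cell a n.+1 x)%:~R : R) =
    (fun x => (slicer_cell a n x)%:~R) \+ slicer_velocity a n.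
  by apply/funext => x; rewrite /slicer_velocity /= intrB addrC subrK.
by apply: measurable_funD => //; exact: mvel.
Qed.

Lemma uniform_prob_subitv {R : realType} (a b c d : R) (ab : a < b) :
  a <= c -> c <= d -> d <= b ->
  uniform_prob ab `]c, d] = ((d - c) / (b - a))%:E.
Proof.
move=> ac cd db.
rewrite -[`]c, d]%classic]setIT -integral_indic// integral_uniform//; last first.
  exact/measurable_EFinP/measurable_indic.
rewrite integral_indic//= setIidl; last first.
  by move=> x /=; rewrite !in_itv/= => /andP[cx xd];
    rewrite (le_trans ac (ltW cx)) (le_trans xd db).
rewrite lebesgue_measure_itv/= lte_fin -EFinB mulrC.
(* The case $c=d$ is separate: there the interval is empty and both sides vanish. *)
by case: ltP => // dc; rewrite (le_anti (introT andP (conj cd dc))) subrr mulr0 mule0.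
Qed.

(** Recording [f] by its deviation from 1 makes all but [N] intervals contribute nothing, so no
    infinite sum of integrals arises. *)
Lemma expectation_uniform_step {R : realType} (f : R -> R) (p q : R) (pq : p < q)
    (c : nat -> R) (t : nat -> R) (N : nat) :
  measurable_fun [set: R] f ->
  {homo t : m n / (m <= n)%N >-> m <= n} -> t 0%N = p -> (t N <= q) ->
  (forall k x, (k < N)%N -> t k < x <= t k.+1 -> f x = 1 + c k) ->
  (forall x, t N < x <= q -> f x = 1) ->
  ('E_(uniform_prob pq)[f] =
    (1 + \sum_(0 <= k < N) c k * ((t k.+1 - t k) / (q - p)))%R%:E)%E.
Proof.
move=> mf t_homo t0 tN f_in f_out.
pose A k := `]t k, t k.+1]%classic.
have indicA k x : \1_(A k) x = (t k < x <= t k.+1)%R%:R :> R.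
  by rewrite indicE; congr (_%:R); congr nat_of_bool;
    apply/idP/idP; rewrite inE /A /= in_itv.
pose g (x : R) := 1 + \sum_(0 <= k < N) c k * \1_(A k) x.
have mA k : measurable (A k) by exact: measurable_itv.
have mg : measurable_fun [set: R] g.
  apply: measurable_funD => //; apply: measurable_sum => k.
  by apply: measurable_funM => //; exact: measurable_indic.
have fg x : p < x <= q -> f x = g x.
  move=> /andP[px xq]; rewrite /g; have [Nx|xN] := ltP (t N) x.
    rewrite f_out ?Nx// big_nat big1 ?addr0// => k /= kN.
    by rewrite indicA [x <= _]leNgt (le_lt_trans (t_homo _ _ kN))// andbF mulr0.
  have [k] : exists k, (k < N)%N && (t k < x <= t k.+1).
    (* The least [n] with [x <= t n] locates the interval; it is nonzero because [t 0 = p < x]. *)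
    have ex : exists n, x <= t n by exists N.
    case: (ex_minnP ex) => -[|k] xk kmin; first by move: xk; rewrite t0 leNgt px.
    exists k; rewrite xk andbT ltNge; have -> := kmin _ xN; rewrite /=.
    by apply/negP => /kmin; rewrite ltnn.
  move=> /andP[kN /andP[kx xk]]; rewrite (f_in k)// ?kx//; congr (_ + _).
  rewrite (bigD1_seq k) ?mem_index_iota ?iota_uniq//=.
  rewrite indicA kx xk mulr1 big1 ?addr0// => j jk.
  rewrite indicA; case: (ltngtP j k) jk => // jk _.
    by rewrite [x <= _]leNgt (le_lt_trans (t_homo _ _ jk))// andbF mulr0.
  by rewrite ltNge (le_trans xk (t_homo _ _ jk)) mulr0.
rewrite unlock.
transitivity (\int[uniform_prob pq]_x (g x)%:E)%E.
  apply: ae_eq_integral => //; [exact/measurable_EFinP | exact/measurable_EFinP|].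
  (* [f] and [g] agree on []p, q]], whose complement is null for the uniform law. *)
  exists (~` `]p, q]); split; first exact: measurableC.
    apply: (etrans (probability_setC _ _)) => //.
    rewrite [X in (1 - X)%E](uniform_prob_subitv _ _ _ _ pq) ?(ltW pq)// divff ?subee//.
    by rewrite subr_eq0 gt_eqF.
  move=> x /= fgx /= xpq; apply: fgx => _; congr EFin; apply: fg.
  by rewrite in_itv in xpq.
have intA k : (uniform_prob pq).-integrable [set: R]
    (fun x => (c k)%:E * (\1_(A k) x)%:E)%E.
  apply: integrableZl => //; exact: (integrable_indic (uniform_prob pq) (mA k)).
under eq_integral do rewrite EFinD -sumEFin.
rewrite integralD//=; last 2 first.
- exact: (finite_measure_integrable_cst (uniform_prob pq)).
- by apply: integrable_sum => // k _; exact: intA.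
rewrite integral_cst//= probability_setT mul1e EFinD; congr (_ + _)%E.
rewrite integral_sum// -sumEFin !big_nat; apply: eq_bigr => k /= kN.
under eq_integral do rewrite EFinM.
rewrite integralZl//; last exact: (integrable_indic (uniform_prob pq) (mA k)).
have -> : (\int[uniform_prob pq]_x (\1_(A k) x)%:E = uniform_prob pq (A k))%E.
  rewrite integral_indic//; [exact: (congr1 (uniform_prob pq) (setIT (A k))) | exact: mA].
rewrite /A uniform_prob_subitv//.
- by rewrite -t0 t_homo.
- by rewrite t_homo.
- by rewrite (le_trans _ tN)// t_homo.
Qed.

(** * The correlation as a finite sum *)

Lemma slicer_vacfE {R : realType} (a : R) (n1 n2 N : nat) : 0 < a ->
  (n1 <= N)%N -> (n2 <= N)%N ->
  slicer_vacf a n1 n2 = 1 + 2 * \sum_(0 <= k < N)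
    (trapped_velocity k.+1 n1 * trapped_velocity k.+1 n2 - 1) *
    slicer_Delta a k.+1.
Proof.
move=> a0 n1N n2N; rewrite /slicer_vacf.
rewrite (@expectation_uniform_step _ _ _ _ _
  (fun k => trapped_velocity k.+1 n1 * trapped_velocity k.+1 n2 - 1)
  (fun k => slicer_ell_plus a k%:Z) N) /=.
- congr (_ + _); rewrite mulr_sumr; apply: eq_bigr => k _.
  rewrite [RHS]mulrCA; congr (_ * _).
  (* Dividing by the length of the right half gives the density factor 2. *)
  have -> : 1 - 2^-1 = 2^-1 :> R by lra.
  by rewrite invrK mulrC.
- by apply: measurable_funM; apply: (measurable_slicer_cell a _).2.
- by move=> m n mn; exact: slicer_ell_plus_homo.
- exact: slicer_ell_plus0.
- exact/ltW/slicer_ell_plus_lt1.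
- move=> k x kN xk; have x21 : 2^-1 < x <= 1.
    move: xk => /andP[kx xk]; apply/andP; split.
      by rewrite -(slicer_ell_plus0 a)// (le_lt_trans _ kx)// slicer_ell_plus_homo.
    by rewrite (le_trans xk)// ltW// slicer_ell_plus_lt1.
  by rewrite !(slicer_velocity_trapped a x k)// addrC subrK.
- move=> x /andP[Nx x1]; have x21 : 2^-1 < x <= 1.
    rewrite x1 andbT.
    by rewrite -(slicer_ell_plus0 a)// (le_lt_trans _ Nx)// slicer_ell_plus_homo.
  by rewrite !(slicer_velocity_rising a x N)// mulr1.
Qed.

(** The leading minus sign absorbs the shift in $n-(k+1)$, and $n-k$ has the parity of $n+k$, which
    avoids truncated subtraction. *)
Lemma trapped_velocityE {R : realType} (k n : nat) : (k < n)%N ->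
  trapped_velocity k.+1 n = (-1) ^+ (n + k) :> R.
Proof.
rewrite /trapped_velocity ltnS => kn; rewrite leqNgt kn /=.
rewrite -[in LHS]mulN1r -exprS -signr_odd -[RHS]signr_odd; congr (_ ^+ nat_of_bool _).
by lia.
Qed.

Lemma trapped_velocity_norm {R : realType} (k n : nat) :
  `|trapped_velocity k n : R| = 1.
Proof.
by rewrite /trapped_velocity; case: ifP => _; rewrite ?normrN ?normrX ?normrN normr1 ?expr1n.
Qed.

Lemma big_nat_double {V : nmodType} (F : nat -> V) (n : nat) :
  \sum_(0 <= k < n.*2) F k = \sum_(0 <= j < n) (F j.*2 + F j.*2.+1).
Proof.
elim: n => [|n IH]; first by rewrite !big_geq.
by rewrite doubleS !big_nat_recr//= IH addrA.
Qed.

(** * Correlation with the initial velocity *)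

Lemma slicer_vacf0E {R : realType} (a : R) (n : nat) : 0 < a ->
  slicer_vacf a 0 n =
  1 + 2 * \sum_(0 <= k < n) ((-1) ^+ (n + k) - 1) * slicer_Delta a k.+1.
Proof.
move=> a0; rewrite (slicer_vacfE _ _ _ n)//; congr (1 + 2 * _).
rewrite !big_nat; apply: eq_bigr => k /= kn.
by rewrite [trapped_velocity _ n]trapped_velocityE// /trapped_velocity/= mul1r.
Qed.

Lemma signr_double {R : nzRingType} (n : nat) : (-1) ^+ n.*2 = 1 :> R.
Proof. by rewrite -signr_odd odd_double. Qed.

(** In each pair $k=2j,2j+1$ the first coefficient is 0 and the second is $-2$, so only
    $\Delta_{2j+2}$ survives. *)
Lemma slicer_vacf0_even {R : realType} (a : R) (n : nat) : 0 < a ->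
  slicer_vacf a 0 n.*2 =
  1 - 4 * series (fun j : nat => slicer_Delta a j.+1.*2) n.
Proof.
move=> a0; rewrite slicer_vacf0E// big_nat_double /series/= mulr_sumr -mulrN -sumrN.
rewrite mulr_sumr; congr (1 + _); apply: eq_bigr => j _.
by rewrite addnS -doubleD exprS signr_double doubleS; ring.
Qed.

(** Now the $\Delta_{2j+1}$ with $j\le n$ survive; they are the telescoped total up to $2n+1$ minus
    the even-indexed terms. *)
Lemma slicer_vacf0_odd {R : realType} (a : R) (n : nat) : 0 < a ->
  slicer_vacf a 0 n.*2.+1 =
  1 - 4 * (slicer_ell_plus a n.*2.+1%:Z - 2^-1
           - series (fun j : nat => slicer_Delta a j.+1.*2) n).
Proof.
move=> a0; rewrite slicer_vacf0E// -(slicer_ell_plus0 _ a0).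
have -> : series (fun j : nat => slicer_Delta a j.+1.*2) n =
    \sum_(0 <= j < n) slicer_Delta a j.*2.+2.
  by apply: eq_bigr => j _; rewrite doubleS.
rewrite -(sum_slicer_Delta _ 0)// !big_nat_recr//= !big_nat_double.
rewrite [in RHS]big_split /= (eq_bigr (fun j : nat => - 2 * slicer_Delta a j.*2.+1)).
  by rewrite -mulr_sumr addSn -doubleD exprS signr_double; ring.
by move=> j _; rewrite !addnS !addSn -doubleD !exprS signr_double; ring.
Qed.

Lemma is_cvg_slicer_R {R : realType} (a : R) : 0 < a ->
  cvgn (series (fun j : nat => slicer_Delta a j.+1.*2)).
Proof.
move=> a0; apply: nondecreasing_is_cvgn.
  by apply: nondecreasing_series => k _ _; exact: slicer_Delta_ge0.
exists 1 => _ [n _ <-].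
(* Adding the nonnegative odd-indexed terms turns the partial sum into a telescoping one. *)
apply: (@le_trans _ _ (\sum_(0 <= k < n.*2) slicer_Delta a k.+1)).
  rewrite big_nat_double; apply: ler_sum => j _.
  by rewrite doubleS lerDr slicer_Delta_ge0.
rewrite sum_slicer_Delta// slicer_ell_plus0//.
have := slicer_ell_plus_lt1 a n.*2%:Z; lra.
Qed.

(** * Correlation at two late times *)

(** With $s=(-1)^{n_1+n_2}$, the terms $k<n_1$ turn the leading 1 into $s-2(s-1)\ell_{n_1}$, an
    error of at most $4\ell_{n_1}$; the tail [B], doubled, costs at most another $4\ell_{n_1}$. *)
Lemma slicer_vacf_dist {R : realType} (a : R) (n1 n2 : nat) : 0 < a ->
  (n1 < n2)%N ->
  `|slicer_vacf a n1 n2 - (-1) ^+ (n1 + n2)| <= 8 * slicer_ell a n1%:Z.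
Proof.
move=> a0 n12; set s := (-1) ^+ (n1 + n2) : R.
rewrite (slicer_vacfE _ _ _ n2)//; last exact: ltnW.
rewrite (big_cat_nat (leq0n n1) (ltnW n12))/=.
set B := (X in 1 + 2 * (_ + X)).
have -> : \sum_(0 <= k < n1) (trapped_velocity k.+1 n1 * trapped_velocity k.+1 n2 - 1)
    * slicer_Delta a k.+1 = (s - 1) * (2^-1 - slicer_ell a n1%:Z).
  have -> : 2^-1 - slicer_ell a n1%:Z = \sum_(0 <= k < n1) slicer_Delta a k.+1.
    by rewrite sum_slicer_Delta// slicer_ell_plus0// /slicer_ell_plus; lra.
  rewrite mulr_sumr !big_nat; apply: eq_bigr => k /= kn.
  have kn2 := ltn_trans kn n12.
  rewrite (trapped_velocityE _ _ kn) (trapped_velocityE _ _ kn2) -exprD.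
  have -> : (n1 + k + (n2 + k) = k.*2 + (n1 + n2))%N by lia.
  by rewrite exprD signr_double mul1r.
have B_le : `|B| <= 2 * slicer_ell a n1%:Z.
  (* Each coefficient has modulus at most 2, and the increments beyond $n_1$ total less than
     $1-\ell_{n_1}^+=\ell_{n_1}$. *)
  apply: (@le_trans _ _ (\sum_(n1 <= k < n2) 2 * slicer_Delta a k.+1)).
    rewrite (le_trans (ler_norm_sum _ _ _))//; apply: ler_sum => k _.
    rewrite normrM (ger0_norm (slicer_Delta_ge0 _ _ a0)).
    rewrite ler_wpM2r ?slicer_Delta_ge0// (le_trans (ler_normB _ _))//.
    by rewrite normrM !trapped_velocity_norm normr1 mulr1.
  rewrite -mulr_sumr ler_wpM2l// sum_slicer_Delta ?(ltnW n12)//.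
  have := slicer_ell_plus_lt1 a n2%:Z; rewrite [slicer_ell_plus a n1%:Z]/slicer_ell_plus; lra.
have := slicer_ell_gt0 a n1%:Z; move: B_le; rewrite !ler_norml.
(* Fixing $s=\pm1$ makes the remaining inequalities linear. *)
rewrite /s -signr_odd; case: odd; rewrite ?expr0 ?expr1; lra.
Qed.

Lemma slicer_ell_near0 {R : realType} (a e : R) : 0 < a -> 0 < e ->
  \forall n \near \oo, 8 * slicer_ell a n%:Z < e.
Proof.
move=> a0 e0; have e80 : 0 < e / 8 by rewrite divr_gt0.
have /cvgr0Pnorm_lt/(_ _ e80) := slicer_ell_cvg0 a a0.
apply: filterS => n; rewrite gtr0_norm ?slicer_ell_gt0// => ?; lra.
Qed.

Theorem mainTheorem8 (R : realType) (a : R) (a_gt0 : 0 < a) :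
  [/\ slicer_vacf a 0 n.*2 @[n --> \oo] --> 1 - 4 * slicer_R a,
      slicer_vacf a 0 n.*2.+1 @[n --> \oo] --> - 1 + 4 * slicer_R a,
      (forall e : R, 0 < e ->
        \forall n1 \near \oo, forall n2 : nat, (n1 < n2)%N ->
          odd n1 = odd n2 -> `|slicer_vacf a n1 n2 - 1| < e)
    & (forall e : R, 0 < e ->
        \forall n1 \near \oo, forall n2 : nat, (n1 < n2)%N ->
          odd n1 <> odd n2 -> `|slicer_vacf a n1 n2 - (- 1)| < e)].
Proof.
have cvgR := is_cvg_slicer_R a a_gt0.
split.
- under eq_fun do rewrite slicer_vacf0_even//.
  by apply: cvgB; [exact: cvg_cst | exact: cvgMl_tmp].
- under eq_fun do rewrite slicer_vacf0_odd//.
  (* This form matches the limits termwise: $\ell^+_{2n+1}\to1-0$, and the odd-indexed increments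
     sum to $\tfrac12-R_\alpha$. *)
  have -> : - 1 + 4 * slicer_R a = 1 - 4 * (1 - 0 - 2^-1 - slicer_R a) by lra.
  apply: cvgB; first exact: cvg_cst.
  apply: cvgMl_tmp; apply: cvgB => //; apply: cvgB; last exact: cvg_cst.
  apply: cvgB; first exact: cvg_cst.
  apply: (cvg_comp (fun n : nat => n.*2.+1) _ _ (slicer_ell_cvg0 a a_gt0)).
  by move=> A [N _ NA]; exists N => // n /= Nn; apply: NA => /=; lia.
(* The bound depends on $n_1$ alone, so one threshold serves every $n_2>n_1$. *)
- move=> e e0; have := slicer_ell_near0 a e a_gt0 e0.
  apply: filterS => n1 n1e n2 n12 n12odd.
  apply: le_lt_trans n1e; have := slicer_vacf_dist a n1 n2 a_gt0 n12.
  by rewrite -[in (-1) ^+ _]signr_odd oddD n12odd addbb.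
- move=> e e0; have := slicer_ell_near0 a e a_gt0 e0.
  apply: filterS => n1 n1e n2 n12 /eqP n12odd.
  apply: le_lt_trans n1e; have := slicer_vacf_dist a n1 n2 a_gt0 n12.
  by rewrite -[in (-1) ^+ _]signr_odd oddD -negb_eqb n12odd expr1.
Qed.
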